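(* Let $h,k\ge 2$ be integers. Every $n$-vertex linear $3$-uniform hypergraph $\mathcal{H}$ with at least $18k\,n^{1+1/h}+42kn$ edges contains Berge cycles of $k$ consecutive lengths, the shortest of which has length at most $2h$.
   Context: All hypergraphs are finite, simple (no repeated edges) and have a non-empty vertex set (so $n\ge 1$). A hypergraph is $3$-uniform if all edges have exactly $3$ vertices, and linear if any two distinct edges share at most one vertex. A Berge cycle of length $\ell$ ($\ell\ge 3$) is a hypergraph consisting of $\ell$ distinct edges $e_1,\dots,e_\ell$ for which there exist $\ell$ distinct vertices $v_1,\dots,v_\ell$ with $v_i,v_{i+1}\in e_i$ for $1\le i\le \ell-1$ and $v_1,v_\ell\in e_\ell$. The conclusion means: there is an integer $a\le 2h$ such that, for every $\ell\in\{a,a+1,\dots,a+k-1\}$, $\mathcal{H}$ contains a Berge cycle of length $\ell$ as a subhypergraph. *)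

(* Defs.v *)
From HB Require Import structures.
From mathcomp Require Import all_boot all_order all_algebra.
From mathcomp Require Import reals exp.

Set Implicit Arguments.
Unset Strict Implicit.
Unset Printing Implicit Defensive.

(* A simple hypergraph with vertex set the finite type V is given by its edge
   set H : {set {set V}}; its number of vertices is #|V| (isolated vertices
   count) and its number of edges is #|H|. *)
Section Hypergraph.
Variable V : finType.
Implicit Types (H C : {set {set V}}) (r l : nat).

Definition uniform r H : Prop := forall e, e \in H -> #|e| = r.

Definition linear_hypergraph H : Prop :=
  forall e f, e \in H -> f \in H -> e != f -> #|e :&: f| <= 1.

(* ordS is the cyclic successor on 'I_l, so the last edge contains the last
   and the first of the vertices v i. *)
Definition berge_cycle l C : Prop :=
  3 <= l /\
  exists e : 'I_l -> {set V},
    [/\ injective e,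
        C = [set e i | i : 'I_l] &
        exists2 v : 'I_l -> V,
          injective v & forall i, v i \in e i /\ v (ordS i) \in e i].

Definition contains_berge_cycle l H : Prop :=
  exists2 C : {set {set V}}, C \subset H & berge_cycle l C.

End Hypergraph.

(* Main.v *)
Require Import Defs.
From mathcomp Require Import all_boot all_order all_algebra.
From mathcomp Require Import reals exp.
From mathcomp Require Import zify lra.

Set Implicit Arguments.
Unset Strict Implicit.
Unset Printing Implicit Defensive.
Import Order.TTheory GRing.Theory Num.Theory.

(** Put N = n^(1/h). Some subhypergraph has all degrees above (38 + 17N)k.
    Explore it in breadth-first layers L_0, L_1, ... from a root. The layers
    cannot grow by a factor N at each of the first h steps, since L_h would
    then contain all n vertices, and the root is not in it. At the first
    layer L_i with |L_(i+1)| < N |L_i|, the edges meeting L_i live on few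
    vertices. Counting degrees over L_i gives a j < h such that the edges
    whose lowest vertex is in L_j outnumber the vertices of L_j and L_(j+1)
    by a factor above 16k/3 ([slow_layer], [layer_degree_sum]).

    Cycles of k consecutive lengths come from such a dense layer
    ([dense_layer_cycles]). Some subset D of L_j meets at least 3/8 of those
    edges in exactly one vertex; call it the foot of the edge. Deleting D
    turns these edges e into the edges e minus D of an ordinary graph, which
    keeps more than 2k edges per vertex, so that it has a connected subgraph
    that is still as dense.

    Below the layer, the exploration tree branches. Let w be the point
    farthest from the root that lies on the branches of all the feet in use.
    Colouring the feet according to the edge or the vertex by which their
    branch leaves w, any two feet of different colours are joined through
    lower layers by a Berge path of the same length c <= 2j ([layer_links]).

    The colour of its foot colours each graph edge, and both colours occur.
    In a connected graph with more than 2k edges per vertex there is then a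
    path of k+1 edges in which the first edge has one colour and all the
    others have the opposite one ([contrast_path]). For each t from 2 to
    k+1, follow the path from the foot of its first edge to the foot of its
    t-th edge; the two feet have different colours, so a link closes a Berge
    cycle of length c+t. All these lengths are consecutive, parity is no
    obstacle because all the edges after the first have the same colour, and
    the shortest is c+2 <= 2j+2 <= 2h. *)

(** * Berge walks *)

Section Walks.
Variable V : finType.
Implicit Types (e f : {set V}) (H E : {set {set V}}) (p q : seq ({set V} * V)).

(** A Berge walk is stored as its start followed by the pairs (edge, next
    vertex); [unzip1] and [unzip2] recover its edges and its later vertices. *)
Fixpoint walk (x : V) p : bool :=
  if p is (e, v) :: p' then [&& x \in e, v \in e & walk v p'] else true.

Lemma walk_cat x p q :
  walk x (p ++ q) = walk x p && walk (last x (unzip2 p)) q.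
Proof. by elim: p x => [|[e v] p IH] x //=; rewrite IH !andbA. Qed.

Lemma walk_nth x0 x p i : walk x p -> i < size p ->
  (nth x0 (x :: unzip2 p) i \in nth set0 (unzip1 p) i) &&
  (nth x0 (unzip2 p) i \in nth set0 (unzip1 p) i).
Proof.
elim: p x i => [|[e v] p IH] x [|i] //= /and3P[xe ve wp]; first by rewrite xe ve.
by rewrite ltnS => /(IH _ _ wp).
Qed.

Lemma closed_walk_berge_cycle H x p :
  3 <= size p -> walk x p -> last x (unzip2 p) = x ->
  uniq (unzip1 p) -> uniq (unzip2 p) -> {subset unzip1 p <= H} ->
  contains_berge_cycle (size p) H.
Proof.
move=> p3 wp lastp u1 u2 sub.
have s1 : size (unzip1 p) = size p by rewrite size_map.
have s2 : size (unzip2 p) = size p by rewrite size_map.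
pose e (i : 'I_(size p)) := nth set0 (unzip1 p) i.
pose v (i : 'I_(size p)) := nth x (belast x (unzip2 p)) i.
have rotE : x :: unzip2 p = rcons (belast x (unzip2 p)) x.
  by rewrite lastI lastp.
exists [set e i | i : 'I_(size p)].
  by apply/subsetP=> _ /imsetP[i _ ->]; apply/sub/mem_nth; rewrite s1.
split=> //; exists e; split=> //.
  move=> i j /eqP; rewrite nth_uniq ?s1 // => /eqP; exact: val_inj.
have ub : uniq (belast x (unzip2 p)).
  by rewrite -(perm_uniq (s1 := unzip2 p)) // -(perm_cons x) rotE perm_rcons.
exists v.
  move=> i j /eqP; rewrite nth_uniq ?size_belast ?s2 // => /eqP; exact: val_inj.
have vE j : j < size p -> nth x (belast x (unzip2 p)) j = nth x (x :: unzip2 p) j.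
  by move=> jp; rewrite rotE nth_rcons size_belast s2 jp.
move=> i; have /andP[h1 h2] := walk_nth x wp (ltn_ord i).
split; first by rewrite /v vE.
rewrite /v /=; case: (ltnP i.+1 (size p)) => [lti|gei].
  by rewrite modn_small // vE.
have -> : i.+1 = size p by apply/eqP; rewrite eqn_leq gei ltn_ord.
rewrite modnn vE /=; last exact: leq_trans p3.
rewrite -{1}lastp -nth_last s2; suff -> : (size p).-1 = i by [].
by have := ltn_ord i; lia.
Qed.

(** A repeated edge would contain three of the distinct vertices of the walk,
    but each edge has only two vertices outside D. *)
Lemma walk_uniq_edges (D : {set V}) y p :
  (forall e, e \in unzip1 p -> #|e :\: D| = 2) -> walk y p ->
  uniq (y :: unzip2 p) -> (forall v, v \in y :: unzip2 p -> v \notin D) ->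
  uniq (unzip1 p).
Proof.
elim: p y => [|[e x] p IH] y //= card2 /and3P[ye xe wp] /andP[yxp uxp] nD.
have nD' v : v \in x :: unzip2 p -> v \notin D.
  by move=> h; apply: nD; rewrite inE h orbT.
rewrite (IH x) ?andbT //; last by move=> f fp; apply: card2; rewrite inE fp orbT.
apply/negP=> ep; have ip := ep; rewrite -index_mem in ip.
rewrite size_map in ip; have /andP[_] := walk_nth x wp ip.
rewrite nth_index //; set z := nth _ _ _ => ze.
have zp : z \in unzip2 p by rewrite mem_nth ?size_map.
have /subset_leq_card : [set y; x; z] \subset e :\: D.
  apply/subsetP=> u; rewrite !inE -orbA => /or3P[]/eqP->; rewrite ?ye ?xe ?ze andbT.
  - by apply: nD; rewrite mem_head.
  - by apply: nD'; rewrite mem_head.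
  - by apply: nD'; rewrite inE zp orbT.
rewrite card2 ?mem_head //.
have [yx yz] : y != x /\ y != z.
  move: yxp; rewrite inE negb_or => /andP[-> yp]; split=> //.
  by apply: contraNneq yp => ->.
have xz : x != z by move: uxp => /= /andP[xp _]; apply: contraNneq xp => ->.
by rewrite -setUA cardsU1 cards2 !inE (negPf yx) (negPf yz) xz.
Qed.

End Walks.

(** * Breadth-first layers and links below them *)

Section Layers.
Variables (V : finType) (H : {set {set V}}) (r : V).
Hypothesis uniH : uniform 3 H.

(** The root is added at every step, so that iterating from the empty set
    starts the exploration: [ball j] holds the vertices at distance below j,
    and [layer j] those at distance j. *)
Definition spread (X : {set V}) : {set V} :=
  [set v | [|| v == r, v \in X |
     [exists e in H, (v \in e) && ~~ [disjoint e & X]]]].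

Definition ball j := iter j spread set0.
Definition layer j := ball j.+1 :\: ball j.

Lemma sub_ballS j : ball j \subset ball j.+1.
Proof. by apply/subsetP=> v vj; rewrite !inE vj orbT. Qed.

Lemma layer0 v : v \in layer 0 -> v = r.
Proof.
rewrite inE => /andP[_]; rewrite inE /= in_set0 /=.
case/orP=> [/eqP //|/existsP[e /and3P[_ _]]].
by rewrite disjoint_sym disjoints_subset sub0set.
Qed.

Lemma root_ball j : r \in ball j.+1.
Proof. by rewrite !inE eqxx. Qed.

Lemma edge_sub_ball j e : e \in H -> ~~ [disjoint e & ball j] -> e \subset ball j.+1.
Proof.
move=> eH ej; apply/subsetP=> v ve; rewrite inE; apply/or3P; apply: Or33.
by apply/existsP; exists e; rewrite eH ve ej.
Qed.

Lemma layer_parent j : exists F : V -> V * {set V}, forall v, v \in layer j.+1 ->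
  [/\ (F v).1 \in layer j, (F v).2 \in H, v \in (F v).2,
      (F v).1 \in (F v).2 & [disjoint (F v).2 & ball j]].
Proof.
apply: (fin_all_exists (P := fun v (ue : V * {set V}) => v \in layer j.+1 ->
  [/\ ue.1 \in layer j, ue.2 \in H, v \in ue.2, ue.1 \in ue.2
    & [disjoint ue.2 & ball j]])) => v.
have [|_] := boolP (v \in layer j.+1); last by exists (v, set0).
rewrite inE => /andP[vn]; rewrite inE (negPf vn) /=.
have vr : v != r by apply: contraNneq vn => ->; rewrite root_ball.
rewrite (negPf vr) /= => /existsP[e /and3P[eH ve]].
have dj : [disjoint e & ball j].
  apply: contraNT vn => /(edge_sub_ball eH)/subsetP; exact.
case/pred0Pn=> u /andP[/= ue uj]; exists (u, e); split=> //=.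
by rewrite inE uj andbT (disjointFr dj).
Qed.

(** The interior vertices lie in X and each edge meets X.  When X is a ball,
    this keeps a link disjoint from everything built on the layers outside. *)
Definition link (X : {set V}) c (a b : V) : Prop :=
  exists p, exists q, [/\ walk a p, size p = c, uniq (unzip1 p) &
    [/\ unzip2 p = rcons q b, uniq q, {subset q <= X} &
    forall e, e \in unzip1 p -> e \in H /\ ~~ [disjoint e & X]]].

Lemma edge_uniq3 e (s : seq V) : e \in H -> uniq s -> {subset s <= e} -> size s <= 3.
Proof.
move=> eH us se; rewrite -(uniH eH) -(card_uniqP us).
by apply/subset_leq_card/subsetP.
Qed.

(** Linking paths are only asked for between colours, but their length c is
    the same for all pairs: this is what makes the final cycle lengths depend
    on the part of the cycle outside the link alone. *)
Definition separating_links i c (S : {set V}) (chi : V -> bool) : Prop :=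
  (exists s t, [/\ s \in S, t \in S & chi s != chi t]) /\
  forall a b, a \in S -> b \in S -> chi a != chi b -> link (ball i.+1) c a b.

(** The base case is a common neighbour w.  If the edges towards w are not all
    equal, they are the colours, and two of them make a path through w.  If
    they are all the same edge, that edge joins any two vertices of S directly,
    so one vertex can be separated from the rest. *)
Lemma star_links i (S : {set V}) w (f : V -> {set V}) : 1 < #|S| ->
  S \subset layer i.+1 -> w \in ball i.+1 ->
  (forall v, v \in S -> [/\ f v \in H, v \in f v & w \in f v]) ->
  exists chi, exists2 c, 0 < c <= 2 & separating_links i c S chi.
Proof.
move=> S2 sub wi fP.
have fX v : v \in S -> ~~ [disjoint f v & ball i.+1].
  by move=> /fP[_ _ wf]; apply/pred0Pn; exists w; rewrite /= wf wi.
have /card_gt1P[s0 [t0 [s0S t0S st0]]] := S2.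
have [/existsP[t /andP[tS ft]]|/existsPn fc] := boolP [exists t in S, f t != f s0].
  exists (fun v => f v == f s0); exists 2 => //; split.
    by exists s0, t; split=> //; rewrite eqxx (negPf ft).
  move=> a b aS bS fab.
  have [aH af wa] := fP a aS; have [bH bf wb] := fP b bS.
  exists [:: (f a, w); (f b, b)], [:: w]; split=> //=.
  - by rewrite af wa wb bf.
  - by rewrite !inE andbT; apply: contraNneq fab => ->.
  split=> // [v|e]; first by rewrite inE => /eqP->.
  by rewrite !inE => /orP[]/eqP->; split=> //; apply: fX.
have fE t : t \in S -> f t = f s0.
  by move=> tS; apply/eqP; have := fc t; rewrite tS negbK.
exists (fun v => v == s0); exists 1 => //; split.
  by exists s0, t0; split=> //; rewrite eqxx [t0 == _]eq_sym (negPf st0).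
move=> a b aS bS ab.
have [aH af wa] := fP a aS; have [bH bf wb] := fP b bS.
exists [:: (f a, b)], [::]; split=> //=.
  by rewrite af (fE a aS) -(fE b bS) bf.
split=> // e; rewrite inE => /eqP->; split=> //; exact: fX.
Qed.

(** Move S one layer down to its parents.  If the parents coincide, this is the
    star case; otherwise colour S through the parents and lengthen the links
    below by one edge at each end.  The two new edges differ, since one edge
    would hold two vertices and their two distinct parents. *)
Lemma layer_links i (S : {set V}) : S \subset layer i.+1 -> 1 < #|S| ->
  exists chi, exists2 c, 0 < c <= 2 * i.+1 & separating_links i c S chi.
Proof.
elim: i S => [|i IH] S /subsetP sub S2.
  have [F FP] := layer_parent 0.
  apply: (@star_links _ _ r (fun v => (F v).2)) => //.
  - by apply/subsetP.
  - exact: root_ball.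
  - by move=> v /sub/FP[/layer0 <-].
have [F FP0] := layer_parent i.+1; have FP v vS := FP0 v (sub v vS).
pose par v := (F v).1; pose te v := (F v).2.
have parL v : v \in S -> par v \in layer i.+1 by case/FP.
have parB v : v \in S -> par v \in ball i.+2 by move=> /parL; case/setDP.
have [small|big] := leqP #|par @: S| 1.
  have /card_gt1P[s0 [_ [s0S _ _]]] := S2.
  have [|||chi [c c2 sep]] := @star_links i.+1 S (par s0) te S2.
  - by apply/subsetP.
  - exact: parB.
  - move=> v vS; have [_ h1 h2 h3 _] := FP v vS; split=> //.
    suff -> : par s0 = par v by [].
    by apply/(card_le1_eqP small); apply: imset_f.
  exists chi, c => //; case/andP: c2 => -> c2; apply: leq_trans c2 _; lia.
have [|chi [c /andP[c0 ci] [[_ [_ [/imsetP[s sS ->] /imsetP[t tS ->] st]]] lk]]] :=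
  IH (par @: S) _ big.
  by apply/subsetP=> _ /imsetP[v vS ->]; apply: parL.
exists (chi \o par), c.+2; first lia.
split; first by exists s, t.
move=> a b aS bS /= ab.
have [p [q [wp sp up [p2 uq sq ep]]]] := lk _ _ (imset_f _ aS) (imset_f _ bS) ab.
have [aL aH aa pa da] := FP a aS; have [bL bH bb pb db] := FP b bS.
have parq v : v \in S -> par v \notin q.
  by move=> /parL; rewrite inE => /andP[h _]; apply: contra h => /sq.
have pab : par a != par b by apply: contraNneq ab => ->.
have tep v : v \in S -> te v \notin unzip1 p.
  by move=> /FP[_ _ _ _ d]; apply/negP=> /ep[_]; rewrite d.
(* Four distinct vertices do not fit in an edge. *)
have teab : te a != te b.
  apply/eqP=> E.
  have : uniq [:: a; b; par a; par b].
    have neq x y : x \in S -> y \in S -> x != par y.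
      move=> /sub; rewrite inE => /andP[xn _] /parB yB; by apply: contraNneq xn => ->.
    have nab : a != b by apply: contraNneq pab => ->.
    by rewrite /= !inE (negPf nab) (negPf pab) !(negPf (neq _ _ _ _)).
  move=> u4; suff : size [:: a; b; par a; par b] <= 3 by [].
  apply: (edge_uniq3 aH) => // x; rewrite !inE.
  by case/or4P=> /eqP-> //; rewrite -/(te a) E.
exists ((te a, par a) :: rcons p (te b, b)), (par a :: rcons q (par b)).
rewrite /unzip1 /unzip2 /= !map_rcons -/(unzip1 p) -/(unzip2 p) p2 size_rcons sp.
split=> //.
- rewrite aa pa -cats1 walk_cat wp p2 last_rcons /= pb bb //.
- by rewrite rcons_uniq mem_rcons inE (negPf teab) !tep.
split=> //.
- by rewrite /= mem_rcons inE rcons_uniq negb_or pab !parq.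
- move=> v; rewrite inE mem_rcons inE => /or3P[/eqP->|/eqP->|/sq]; rewrite ?parB //.
  exact: (subsetP (sub_ballS _)).
move=> e; rewrite inE mem_rcons inE.
have tX v : v \in S -> ~~ [disjoint te v & ball i.+2].
  move=> vS; have [_ _ _ h _] := FP v vS.
  by apply/pred0Pn; exists (par v); rewrite /= h parB.
case/or3P=> [/eqP->|/eqP->|/ep[eH]]; rewrite ?tX //.
move=> eX; split=> //; apply: contra eX => /disjointWr; apply; exact: sub_ballS.
Qed.

(** The edges whose lowest vertex is in [layer j]. *)
Definition edges_from_layer j :=
  [set e in H | ~~ [disjoint e & ball j.+1] && [disjoint e & ball j]].

Lemma edges_from_layer_sub j e : e \in edges_from_layer j ->
  e \subset ball j.+2 :\: ball j.
Proof.
rewrite inE => /and3P[eH eb dj]; rewrite subsetD dj andbT.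
exact: edge_sub_ball.
Qed.

(** An edge meeting [layer i] has its lowest vertex there or one layer below,
    and in the second case at most two of its vertices count.  A coefficient 3
    there would be too costly for the final count. *)
Lemma layer_degree_sum i :
  \sum_(v in layer i) #|[set e in H | v \in e]| <=
  3 * #|edges_from_layer i| + 2 * (if i is i'.+1 then #|edges_from_layer i'| else 0).
Proof.
set F := (if i is i'.+1 then edges_from_layer i' else set0).
have -> : (if i is i'.+1 then #|edges_from_layer i'| else 0) = #|F|.
  by rewrite /F; case: (i) => //; rewrite cards0.
have subH (A : {set {set V}}) : A \subset H -> #|A| = \sum_(e in H) (e \in A).
  move=> sA; rewrite -sum1_card [RHS](big_setID A) /= (setIidPr sA).
  rewrite [X in _ + X]big1 ?addn0; last by move=> e; rewrite inE => /andP[/negPf->].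
  by apply: eq_bigr => e ->.
have -> : \sum_(v in layer i) #|[set e in H | v \in e]| =
          \sum_(e in H) #|e :&: layer i|.
  under eq_bigr => v _ do rewrite -sum1dep_card.
  rewrite (exchange_big_dep (mem H)) /=; last by move=> v e _ /andP[].
  apply: eq_bigr => e eH; rewrite -sum1_card; apply: eq_bigl => v.
  by rewrite in_setI eH andbC.
rewrite (subH (edges_from_layer i)); last by apply/subsetP=> e; case/setIdP.
rewrite (subH F); last first.
  by rewrite /F; case: (i) => [|?]; [exact: sub0set | apply/subsetP=> e; case/setIdP].
rewrite !big_distrr /= -big_split /=; apply: leq_sum => e eH.
have [->|/set0Pn[v]] := eqVneq (e :&: layer i) set0; first by rewrite cards0.
rewrite inE => /andP[ve vL].
have eb : ~~ [disjoint e & ball i.+1].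
  by apply/pred0Pn; exists v; rewrite /= ve; case/setDP: vL.
have le3 : #|e :&: layer i| <= 3 by rewrite -(uniH eH) subset_leq_card ?subsetIl.
have [di|ndi] := boolP [disjoint e & ball i].
  by rewrite [e \in edges_from_layer i]inE eH eb di /=; lia.
suff -> : e \in F.
  have /pred0Pn[u /andP[/= ue ui]] := ndi.
  have : #|e :&: layer i| < 3; last by lia.
  rewrite -(uniH eH); apply: proper_card; rewrite properE subsetIl.
  by apply/subsetPn; exists u; rewrite // in_setI in_setD ui andbF.
rewrite /F; case: (i) vL eb ndi => [|i'] vL eb ndi.
  by move: ndi; rewrite disjoint_sym disjoints_subset sub0set.
rewrite inE eH ndi /=; apply: contraTT vL => /(edge_sub_ball eH)/subsetP sub.
by rewrite inE sub.
Qed.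

End Layers.

(** * Minimal dense induced subgraphs *)

Section Induced.
Variable V : finType.
Implicit Types (e f D W X : {set V}) (E : {set {set V}}).

(** Seen in the graph with the edges [e :\: D], this is the subgraph induced
    by W; for empty D it is the induced subhypergraph. *)
Definition induced E D W := [set e in E | e :\: D \subset W].

Lemma induced_sub E D W : induced E D W \subset E.
Proof. by apply/subsetP=> e; rewrite inE => /andP[]. Qed.

Lemma induced0 E D : (forall e, e \in E -> e :\: D != set0) -> induced E D set0 = set0.
Proof.
move=> nz; apply/setP=> e; rewrite !inE subset0.
by apply/negP=> /andP[/nz/negPf->].
Qed.

Local Open Scope ring_scope.

(** Minimality of W yields both the degree condition of [core_degree] and the
    connectedness of [core_connected]. *)
Lemma dense_core (R : realDomainType) (x : R) E D W0 :
  x * #|W0|%:R < #|induced E D W0|%:R ->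
  exists W, [/\ W \subset W0, x * #|W|%:R < #|induced E D W|%:R &
    forall X, X \proper W -> #|induced E D X|%:R <= x * #|X|%:R].
Proof.
move=> h; pose P W := x * #|W|%:R < #|induced E D W|%:R.
have [W /minsetP[PW minW] sW] := @minset_exists _ P W0 h.
exists W; split=> // X pX; rewrite leNgt; apply/negP => PX.
by have := pX; rewrite (minW _ PX (proper_sub pX)) properxx.
Qed.

(** Deleting a vertex of degree at most x would leave the density above x. *)
Lemma core_degree (R : realDomainType) (x : R) E D W v :
  x * #|W|%:R < #|induced E D W|%:R ->
  (forall X, X \proper W -> #|induced E D X|%:R <= x * #|X|%:R) ->
  v \in W -> x < #|[set e in induced E D W | v \in e :\: D]|%:R.
Proof.
move=> dW mW vW; have := mW (W :\ v) (properD1 vW).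
set d := #|[set e in _ | _]| => hX.
have : (#|induced E D W| <= #|induced E D (W :\ v)| + d)%N.
  rewrite -[leqRHS](cardsUI (induced E D (W :\ v))
                            [set e in induced E D W | v \in e :\: D]).
  apply: leq_trans (leq_addr _ _); apply/subset_leq_card/subsetP=> e.
  rewrite !(inE, subsetD1) => /andP[-> ->] /=.
  by case: (_ \notin D); case: (v \in e).
rewrite -(ler_nat R) natrD; move: hX dW.
by rewrite (cardsD1 v W) vW natrD mulrDr mulr1; lra.
Qed.

End Induced.

(** * Paths whose first edge alone has its colour *)

Section ContrastPath.
Variables (V : finType) (E : {set {set V}}) (D W : {set V}) (k : nat).
Variable chi : {set V} -> bool.
Hypothesis linE : linear_hypergraph E.
Hypothesis card2 : forall e, e \in E -> #|e :\: D| = 2.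
Let EW := induced E D W.
Hypothesis dense : 2 * k * #|W| < #|EW|.
Hypothesis minW : forall X : {set V}, X \proper W -> #|induced E D X| <= 2 * k * #|X|.
Hypothesis two_colours : exists e f, [/\ e \in EW, f \in EW & chi e != chi f].

(** By linearity [pick] has at most one candidate when u and v differ, so graph
    paths determine their hyperedges. *)
Definition edge_of (u v : V) : {set V} :=
  odflt set0 [pick e in EW | (u \in e) && (v \in e)].

Lemma edge_ofE e u v : e \in EW -> u != v -> u \in e -> v \in e -> edge_of u v = e.
Proof.
move=> eE uv ue ve; rewrite /edge_of; case: pickP => [f|/(_ e)] /=; last first.
  by rewrite eE ue ve.
case/and3P=> fE uf vf; apply: contraNeq uv => fe.
have /card_le1_eqP : #|f :&: e| <= 1.
  by apply: linE fe; apply: (subsetP (induced_sub E D W)).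
by move/(_ u v); rewrite !inE uf ue vf ve => ->.
Qed.

Definition adj c (u v : V) :=
  [&& u != v, u \notin D, v \notin D &
    [exists e in EW, [&& u \in e, v \in e & chi e == c]]].

Lemma adjP c u v : adj c u v ->
  [/\ u != v, u \notin D & v \notin D] /\
  [/\ edge_of u v \in EW, u \in edge_of u v, v \in edge_of u v & chi (edge_of u v) = c].
Proof.
case/and4P=> uv uD vD /existsP[e /and4P[eE ue ve /eqP ce]].
by rewrite (edge_ofE eE uv ue ve).
Qed.

Lemma adjI e u v : e \in EW -> u != v -> u \in e :\: D -> v \in e :\: D ->
  adj (chi e) u v.
Proof.
move=> eE uv; rewrite !inE => /andP[uD ue] /andP[vD ve].
by rewrite /adj uv uD vD; apply/existsP; exists e; rewrite eE ue ve eqxx.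
Qed.

Lemma adj_sym c u v : adj c u v = adj c v u.
Proof.
rewrite /adj eq_sym; congr (_ && _); rewrite !andbA [(u \notin D) && _]andbC.
by congr (_ && _); apply: eq_existsb => e; congr (_ && _); rewrite andbCA.
Qed.

Lemma adj_sub c u v : adj c u v -> u \in W.
Proof.
move=> /adjP[[_ uD _] []]; rewrite inE => /andP[_ /subsetP sub] ue _ _.
by apply: sub; rewrite inE uD.
Qed.

Lemma nonempty_card2 e : e \in E -> e :\: D != set0.
Proof. by move=> /card2 h; rewrite -card_gt0 h. Qed.

Lemma other_end e u : e \in E -> u \in e :\: D -> exists2 v, v \in e :\: D & u != v.
Proof.
move=> /card2 h ue; move: h; rewrite (cardsD1 u) ue add1n => -[h].
have /card_gt0P[v] : 0 < #|(e :\: D) :\ u| by rewrite h.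
by rewrite in_setD1 => /andP[vu ve]; exists v; rewrite // eq_sym.
Qed.

(** If no edge crossed from X to the rest of W, one of the two parts would
    already have the density of W. *)
Lemma core_connected (X : {set V}) : X != set0 -> X \proper W ->
  exists e u v, [/\ e \in EW, u \in e :\: D, v \in e :\: D, u \in X & v \in W :\: X].
Proof.
move=> X0 pX; have sX := proper_sub pX.
have [/existsP[e]|/existsPn no] := boolP
  [exists e in EW, ~~ [disjoint e :\: D & X] && ~~ [disjoint e :\: D & W :\: X]].
  case/and3P=> eE /pred0Pn[u /andP[/= ue uX]] /pred0Pn[v /andP[/= ve vX]].
  by exists e, u, v.
have : #|EW| <= #|induced E D X| + #|induced E D (W :\: X)|.
  rewrite -cardsUI; apply: leq_trans (leq_addr _ _).
  apply/subset_leq_card/subsetP=> e eE; move: (no e); rewrite eE /= negb_and !negbK.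
  move: eE; rewrite !inE => /andP[-> eW] /=.
  rewrite subsetD eW /= orbC => /orP[|->]; last by rewrite orbT.
  rewrite disjoints_subset setCD => h; apply/orP; left.
  apply/subsetP=> v ve; have := subsetP h v ve; rewrite !inE.
  by rewrite (subsetP eW v ve).
have := minW pX; have : W :\: X \proper W.
  rewrite properEcard subsetDl cardsD (setIidPr sX) /=.
  have := X0; rewrite -card_gt0; have := subset_leq_card sX; lia.
move=> /minW; rewrite cardsD (setIidPr sX); have := subset_leq_card sX.
move: dense; set a := #|EW|; set b := #|induced _ _ _|; set c := #|induced _ _ _|.
move=> h1 h2 h3 h4 h5; exfalso; nia.
Qed.

Definition trail (x : V) (t : seq V) := pairmap (fun u v => (edge_of u v, v)) x t.

Lemma unzip2_trail x t : unzip2 (trail x t) = t.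
Proof. by elim: t x => //= v t IH x; rewrite IH. Qed.

Lemma trail_walk c x t : path (adj c) x t -> walk x (trail x t).
Proof.
by elim: t x => //= v t IH x /andP[/adjP[_ [_ -> -> _]] /IH].
Qed.

Lemma trail_edges c x t : path (adj c) x t -> {subset unzip1 (trail x t) <= EW}.
Proof.
elim: t x => //= v t IH x /andP[/adjP[_ [eE _ _ _]] pt] e.
by rewrite inE => /predU1P[->|/(IH _ pt)].
Qed.

Lemma path_adj_vertices c x t v : path (adj c) x t -> v \in t ->
  v \in W /\ v \notin D.
Proof.
elim: t x => //= u t IH x /andP[xu pt]; rewrite inE => /predU1P[->|/(IH _ pt)//].
split; first by move: xu; rewrite adj_sym => /adj_sub.
by case/adjP: xu => -[].
Qed.

(** One colour c has more than k edges per vertex, hence a core U where all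
    c-degrees exceed k and any path can be continued greedily for k steps.
    If some vertex of U meets an edge of the other colour, start with that
    edge. Otherwise consider c-paths that run into U and avoid, after their
    start, the set N of vertices meeting the other colour. By connectedness
    one of them starts in N: the set of starting points could otherwise only
    be left along an edge that extends such a path. Prefix it by an edge of
    the other colour, whose far end is also in N and so off the path, and
    continue inside U. *)
Lemma contrast_path : exists c y x t,
  [/\ adj (~~ c) y x, path (adj c) x t, size t = k & uniq [:: y, x & t]].
Proof.
pose Ec c := [set e in EW | chi e == c].
have EcU : #|EW| <= #|Ec true| + #|Ec false|.
  rewrite -cardsUI; apply: leq_trans (leq_addr _ _).
  apply/subset_leq_card/subsetP=> e eE; rewrite !in_setU !in_set -/EW.
  by move: eE; rewrite inE => ->; case: (chi e).
have [c Ecc] : exists c, k * #|W| < #|Ec c|.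
  case: (ltnP (k * #|W|) #|Ec true|) => h; [by exists true | exists false].
  move: dense EcU h; nia.
have EcE c' e : (e \in Ec c') = (e \in EW) && (chi e == c') by rewrite !inE.
have EcW : induced (Ec c) D W = Ec c.
  apply/setP=> e; rewrite inE andb_idr // EcE => /andP[+ _].
  by rewrite inE => /andP[].
have [|U [sU dU mU]] := @dense_core V int (k%:R)%R (Ec c) D W.
  by rewrite EcW -natrM ltr_nat.
have EcEW e : e \in induced (Ec c) D U -> e \in EW /\ chi e = c.
  by rewrite inE EcE => /andP[/andP[-> /eqP ->]].
have degU u : u \in U -> k < #|[set v in U | adj c u v]|.
  move=> uU; have := core_degree dU mU uU; rewrite ltr_nat => /leq_trans; apply.
  apply: leq_trans (leq_imset_card (edge_of u) _); apply/subset_leq_card/subsetP=> e.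
  rewrite inE => /andP[eI ue]; have [eE ce] := EcEW _ eI.
  have eE' := subsetP (induced_sub _ _ _) _ eE.
  have [v ve uv] := other_end eE' ue.
  apply/imsetP; exists v; last first.
    by rewrite (edge_ofE eE) //; [case/setDP: ue | case/setDP: ve].
  rewrite inE -ce (adjI eE uv ue ve) andbT.
  by move: eI; rewrite inE => /andP[_ /subsetP]; apply.
(* The visited vertices of U are the m steps, x, and possibly one vertex of s;
   without the current one they are at most m + 1 <= k, fewer than its
   neighbours in U. *)
have greedy m s x : m <= k -> x \in U -> uniq (rcons s x) -> count (mem U) s <= 1 ->
    exists q, [/\ size q = m, path (adj c) x q, all (mem U) q & uniq (rcons s x ++ q)].
  move=> mk xU us cs; elim: m mk => [_|m IH mk].
    by exists [::]; split; rewrite ?cats0.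
  have [q [sq pq aq uq]] := IH (ltnW mk).
  pose z := last x q.
  have zU : z \in U.
    rewrite /z; case/lastP: q aq {sq pq uq z} => [|q z] //.
    by rewrite all_rcons last_rcons => /andP[].
  have [v vN vn] : exists2 v, v \in [set v in U | adj c z v] & v \notin rcons s x ++ q.
    apply/exists_inP; apply: contraT; rewrite negb_exists_in => /forall_inP h.
    suff : #|z |: [set v in U | adj c z v]| <= m.+2.
      rewrite cardsU1 !inE zU /= {1}/adj eqxx /=; have := degU z zU; lia.
    apply: leq_trans (_ : #|[seq v <- rcons s x ++ q | v \in U]| <= _).
      apply/subset_leq_card/subsetP=> v; rewrite in_setU1 mem_filter.
      case/orP=> [/eqP->|vN].
        rewrite zU /= mem_cat mem_rcons /z; have := mem_last x q.
        by rewrite inE => /orP[/eqP->|->]; rewrite ?inE ?eqxx ?orbT.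
      by have := h v vN; rewrite negbK => ->; rewrite andbT; case/setIdP: vN.
    apply: leq_trans (card_size _) _; rewrite size_filter count_cat -cats1 count_cat /=.
    rewrite -[count _ s]/(count (mem U) s) -[count _ q]/(count (mem U) q) xU addn0.
    have := count_size (mem U) q; rewrite sq; lia.
  exists (rcons q v); move: vN; rewrite inE => /andP[vU av].
  rewrite size_rcons sq rcons_path pq all_rcons aq -/z av; split; rewrite ?andbT //.
  by rewrite -rcons_cat rcons_uniq vn.

(* The vertices that meet an edge of the colour opposite to c. *)
pose N := [pred v | [exists y, adj (~~ c) y v]].
have [x0 Nx0] : exists x, N x.
  have [e [f [eE fE ef]]] := two_colours.
  have [g [gE cg]] : exists g, g \in EW /\ chi g = ~~ c.
    case: (chi e =P ~~ c) => he; first by exists e.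
    by exists f; split=> //; move: ef he; case: (chi e); case: (chi f); case: (c).
  have gE' := subsetP (induced_sub _ _ _) _ gE.
  have /set0Pn[u ug] := nonempty_card2 gE'.
  have [v vg uv] := other_end gE' ug.
  by exists v; apply/existsP; exists u; rewrite -cg; apply: adjI.
have [/exists_inP[x xU /existsP[y yx]]|noU] := boolP [exists x in U, N x].
  have [||q [sq pq _ uq]] := greedy k [:: y] x (leqnn k) xU.
  - by rewrite /= inE andbT; case/adjP: yx => -[].
  - by rewrite /= addn0; case: (y \in U).
  by exists c, y, x, q.
rewrite negb_exists_in in noU; move/forall_inP in noU.
pose r u v := adj c u v && ~~ N v.
pose Z := [set u in W | [exists w in U, connect r u w]].
have sUZ : U \subset Z.
  apply/subsetP=> u uU; rewrite inE (subsetP sU) //=.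
  by apply/exists_inP; exists u.
have [x xZ Nx] : exists2 x, x \in Z & N x.
  apply/exists_inP; apply: contraT; rewrite negb_exists_in => /forall_inP noZ.
  have NW v : N v -> v \in W by case/existsP=> y; rewrite adj_sym => /adj_sub.
  have [||e [z [u [eE ze ue zZ /setDP[uW uZ]]]]] := @core_connected Z.
  - have /set0Pn[u uU] : U != set0.
      apply: contraTneq dU => ->; rewrite induced0 ?cards0 ?mulr0 ?ltxx // => e.
      by rewrite EcE => /andP[/(subsetP (induced_sub _ _ _))/nonempty_card2].
    by apply/set0Pn; exists u; apply: (subsetP sUZ).
  - rewrite properE; apply/andP; split; first by apply/subsetP=> u; case/setIdP.
    by apply/subsetPn; exists x0; [apply: NW | apply: contraL Nx0 => /noZ].
  have uz : u != z by apply: contraNneq uZ => ->.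
  have a := adjI eE uz ue ze; case/negP: uZ; rewrite inE uW /=.
  have [ce|ce] := eqVneq (chi e) c; last first.
    case/negP: (noZ z zZ); apply/existsP; exists u.
    by have <- : chi e = ~~ c by move: ce; case: (chi e); case: (c).
  have /setIdP[_ /exists_inP[w wU zw]] := zZ; apply/exists_inP; exists w => //.
  apply: connect_trans zw; apply: connect1; rewrite /r -{1}ce a /=.
  exact: noZ.
have /existsP[y yx] := Nx.
case/setIdP: xZ => _ /exists_inP[w wU /connectP[p0 pr0 lw]].
case/shortenP: pr0 lw => p pr up _ lw.
have xU : x \notin U by apply: contraL Nx => /noU.
have hasU : has (mem U) p.
  apply/hasP; exists w => //; move: (mem_last x p); rewrite -lw inE.
  by case/predU1P=> // xw; rewrite -xw wU in xU.
have rP u s : path r u s -> path (adj c) u s && all (predC N) s.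
  elim: s u => //= a s IH u /andP[/andP[-> ->] /IH/andP[-> ->]] //.
case/andP: (rP _ _ pr) => pa aN {rP}.
(* Cut the path at its first entry in U, so that the greedy continuation can
   only run into its own steps. *)
case/split_find: hasU pa aN up => u p1 p2 uU noU1 pa aN up.
rewrite cat_path in pa; case/andP: pa => pa _.
rewrite all_cat in aN; case/andP: aN => aN _.
move: up; rewrite -cat_cons cat_uniq => /andP[up _].
have yN : N y by apply/existsP; exists x; rewrite adj_sym.
have yp : y \notin rcons p1 u.
  by apply: contraL yN => /(allP aN).
have yxn : y != x by case/adjP: yx => -[].
have noyx : count (mem U) [:: y, x & p1] = 0.
  rewrite /= (negPf xU) (_ : y \in U = false) ?add0n.
    by apply/eqP; rewrite -leqn0 leqNgt -has_count.
  by apply: contraTF yN => /noU.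
have [||q [sq pq _ uq]] := greedy k [:: y, x & p1] u (leqnn k) uU.
- by rewrite !rcons_cons cons_uniq up inE negb_or yxn yp.
- by apply: leq_trans (eq_leq noyx) _.
pose t := rcons p1 u ++ q.
have pt : path (adj c) x t by rewrite cat_path pa last_rcons.
have st : k <= size t by rewrite size_cat sq leq_addl.
have ut : uniq [:: y, x & t].
  by move: uq; rewrite !rcons_cons.
exists c, y, x, (take k t). split.
- by [].
- exact: take_path.
- by rewrite size_takel.
- exact: (take_uniq k.+2 ut).
Qed.
End ContrastPath.

(** * Sets meeting many edges exactly once *)

Section Splitting.
Variable V : finType.

(** Such a T is a point of s together with any subset of the complement. *)
Lemma card_singleton_traces (s : {set V}) :
  #|s| * 2 ^ (#|V| - #|s|) <= #|[set T : {set V} | #|s :&: T| == 1]|.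
Proof.
have cC : #|~: s| = #|V| - #|s| by rewrite -(cardsC s) addKn.
rewrite -cC -card_powerset -cardsX.
have inj : {in setX s (powerset (~: s)) &,
    injective (fun vT : V * {set V} => vT.1 |: vT.2)}.
  move=> [v T] [w U]; rewrite !inE /= => /andP[vs Ts] /andP[ws Us] E.
  have memC (X : {set V}) x : X \subset ~: s -> x \in X -> x \notin s.
    by move=> /subsetP sub /sub; rewrite inE.
  have vw : v = w.
    have : v \in w |: U by rewrite -E setU11.
    by rewrite in_setU1 => /orP[/eqP //|/(memC _ _ Us)]; rewrite vs.
  congr (_, _) => //; apply/setP=> x.
  have [xs|xs] := boolP (x \in s).
    by apply/idP/idP => [/(memC _ _ Ts)|/(memC _ _ Us)]; rewrite xs.
  have := congr1 (fun X : {set V} => x \in X) E; rewrite /= !in_setU1 vw.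
  by have /negPf-> : x != w by apply: contraNneq xs => ->.
rewrite -(card_in_imset inj); apply/subset_leq_card/subsetP=> _ /imsetP[[v T] + ->].
rewrite !inE /= => /andP[vs Ts]; apply/cards1P; exists v.
apply/setP=> x; rewrite !inE; case: eqVneq => [->|_] /=; first by rewrite vs.
by apply/negP=> /andP[xs /(subsetP Ts)]; rewrite inE xs.
Qed.

(** Average over all subsets of P: a set of size t is hit once by a fraction
    t / 2^t of them, which for t = 1, 2, 3 is at least 3/8. *)
Lemma exists_single_hitting_set (F : {set {set V}}) (P : {set V}) :
  (forall e, e \in F -> 0 < #|e :&: P| <= 3) ->
  exists2 D : {set V}, D \subset P &
    3 * #|F| <= 8 * #|[set e in F | #|e :&: D| == 1]|.
Proof.
move=> F3; pose hit (T : {set V}) := [set e in F | #|e :&: (P :&: T)| == 1].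
suff [T hT] : exists T, 3 * #|F| <= 8 * #|hit T|.
  by exists (P :&: T); rewrite ?subsetIl.
apply/existsP; apply: contraT; rewrite negb_exists => /forallP no.
have sumE : \sum_(T : {set V}) #|hit T| =
            \sum_(e in F) #|[set T : {set V} | #|(e :&: P) :&: T| == 1]|.
  transitivity (\sum_(T : {set V}) \sum_(e in F | #|e :&: (P :&: T)| == 1) 1).
    by apply: eq_bigr => T _; rewrite sum1dep_card.
  rewrite (exchange_big_dep (mem F)) /=; last by move=> T e _ /andP[].
  apply: eq_bigr => e eF; rewrite -sum1dep_card; apply: eq_bigl => T.
  by rewrite eF setIA.
have low : 3 * #|F| * 2 ^ #|V| <= 8 * \sum_(T : {set V}) #|hit T|.
  rewrite sumE -sum1_card big_distrr big_distrl big_distrr /=; apply: leq_sum => e eF.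
  have := card_singleton_traces (e :&: P); have := F3 e eF.
  have : #|e :&: P| <= #|V| by apply: max_card.
  set t := #|e :&: P| => tV t3 /(leq_mul (leqnn 8)); apply: leq_trans.
  rewrite -[in leqLHS](subnKC tV) expnD.
  by case: (t) t3 => [|[|[|[|]]]] //= _; lia.
have : 8 * \sum_(T : {set V}) #|hit T| < \sum_(T : {set V}) 3 * #|F|.
  rewrite big_distrr /=; have := no set0; rewrite -ltnNge => h0.
  rewrite (bigD1 set0) // [ltnRHS](bigD1 set0) //= -addSn leq_add //.
  by apply: leq_sum => T _; apply: ltnW; rewrite ltnNge no.
have card2V : #|{set V}| = 2 ^ #|V|.
  by rewrite -[in RHS]cardsT -card_powerset powersetT cardsT.
rewrite sum_nat_const card2V [ltnRHS]mulnC => /(leq_ltn_trans low).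
by rewrite ltnn.
Qed.

End Splitting.

(** * Cycles from a dense layer *)

Section DenseLayer.
Variables (V : finType) (H : {set {set V}}) (r : V).
Hypothesis uniH : uniform 3 H.
Hypothesis linH : linear_hypergraph H.

Local Notation ball := (ball H r).
Local Notation layer := (layer H r).
Local Notation edges_from_layer := (edges_from_layer H r).

(** This is the construction of the cycles: feet in D, links below the layer,
    and a path of the graph with edges [e :\: D] above them.  Since D is
    disjoint from that graph, a foot never collides with a vertex of the
    path. *)
Lemma dense_layer_cycles j k : 0 < k ->
  16 * k * #|ball j.+2 :\: ball j| < 3 * #|edges_from_layer j| ->
  exists2 a, a <= 2 * j.+1 &
    forall l, a <= l < a + k -> contains_berge_cycle l H.
Proof.
move=> k0 dense.
have spanP e : e \in edges_from_layer j ->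
    [/\ e \in H, ~~ [disjoint e & ball j.+1] & [disjoint e & ball j]].
  by rewrite inE => /and3P.
have [|D DL hE] := @exists_single_hitting_set _ (edges_from_layer j) (layer j).
  move=> e /spanP[eH eb dj]; rewrite -(uniH eH) subset_leq_card ?subsetIl // andbT.
  have /pred0Pn[u /andP[/= ue ui]] := eb.
  rewrite card_gt0; apply/set0Pn; exists u.
  by rewrite in_setI in_setD ue ui (disjointFr dj).
set E := [set e in edges_from_layer j | _] in hE.
have EP e : e \in E -> e \in edges_from_layer j /\ #|e :&: D| = 1.
  by rewrite inE => /andP[-> /eqP].
have EH e : e \in E -> e \in H by case/EP => /spanP[].
have linE : linear_hypergraph E by move=> e f /EH eH /EH fH; apply: linH.
have card2 e : e \in E -> #|e :\: D| = 2.
  by move=> eE; rewrite cardsD (uniH (EH _ eE)); case/EP: eE => _ ->.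
have indE : induced E D (ball j.+2 :\: ball j) = E.
  apply/setP=> e; rewrite inE andb_idr // => /EP[/edges_from_layer_sub sub _].
  by apply: subset_trans sub; apply: subsetDl.
have [|W [sW dW mW]] := @dense_core V int (2 * k)%:R%R E D (ball j.+2 :\: ball j).
  rewrite indE -natrM ltr_nat; nia.
have degW u : u \in W -> 1 < #|[set e in induced E D W | u \in e :\: D]|.
  by move=> uW; have := core_degree dW mW uW; rewrite ltr_nat; lia.
have {}dW : 2 * k * #|W| < #|induced E D W| by rewrite -(ltr_nat int) natrM.
have {}mW (X : {set V}) : X \proper W -> #|induced E D X| <= 2 * k * #|X|.
  by move=> /mW; rewrite -natrM ler_nat.
set EW := induced E D W in degW dW.
have EWE e : e \in EW -> e \in E := subsetP (induced_sub _ _ _) e.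
(* delta e is the foot of e. *)
pose delta e : V := odflt r [pick d in e :&: D].
have deltaP e : e \in E -> [/\ delta e \in e, delta e \in D &
    forall d, d \in e -> d \in D -> d = delta e].
  move=> eE; have [_ c1] := EP e eE.
  have [d0 dE] := cards1P (introT eqP c1).
  rewrite /delta; case: pickP => [d|/(_ d0)]; last by rewrite dE set11.
  move=> /=; rewrite dE => /set1P->.
  have : d0 \in e :&: D by rewrite dE set11.
  rewrite inE => /andP[-> ->]; split=> // d' d'e d'D; apply/set1P.
  by rewrite -dE inE d'e.
pose S := [set delta e | e in EW].
have SL : S \subset layer j.
  by apply/subsetP=> _ /imsetP[e /EWE/deltaP[_ dD _] ->]; apply: (subsetP DL).
(* Two edges at a common graph vertex have different feet by linearity. *)
have S2 : 1 < #|S|.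
  have /set0Pn[u uW] : W != set0.
    apply: contraTneq dW => W0; rewrite /EW W0 induced0 ?cards0 // => e /card2 h.
    by rewrite -card_gt0 h.
  have /card_gt1P[e [f]] := degW u uW.
  case=> /setIdP[eW /setDP[ue uD]] /setIdP[fW /setDP[uf _]] ef.
  apply/card_gt1P; exists (delta e), (delta f).
  split; rewrite ?imset_f //; apply: contraNneq uD => dd.
  have [eE fE] := (EWE e eW, EWE f fW).
  have [de dD _] := deltaP e eE; have [df _ _] := deltaP f fE.
  have /card_le1_eqP same := linE _ _ eE fE ef.
  by rewrite (same (delta e) u) // in_setI ?ue // de dd.
(* Two different feet cannot both be the root, so the layer is not the first. *)
have [j' Ej] : exists j', j = j'.+1.
  case: (j) SL => [|j'] SL; last by exists j'.
  have /card_gt1P[s [t [/(subsetP SL) /layer0 -> /(subsetP SL)/layer0 ->]]] := S2.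
  by rewrite eqxx.
have := layer_links uniH (r := r) (i := j') (S := S); rewrite -Ej => /(_ SL S2).
case=> col [c /andP[c0 cj] [[_ [_ [/imsetP[es esE ->] /imsetP[et etE ->] st]]] lk]].
have [|b [y [x [t [yx xt <- uyxt]]]]] :=
  @contrast_path V E D W k (col \o delta) linE card2 dW mW.
  by exists es, et.
have pyxt : walk y (trail E D W y (x :: t)).
  rewrite /= (trail_walk linE xt) andbT.
  by have [_ [_ -> ->]] := adjP linE yx.
exists c.+2; first by rewrite mulnS add2n !ltnS.
move=> l /andP[cl lc].
(* The cycle goes from delta e1 through x :: t1 to the foot of e2 and returns by
   the link: it uses e1, the m edges along t1, e2 and the c edges of the link. *)
have [m lE] : exists m, l = m + c.+2 by exists (l - c.+2); rewrite subnK.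
have {lc} mt : m < size t by move: lc; rewrite lE addnC ltn_add2l.
pose t1 := take m t; pose v := nth x t m; pose u := last x t1.
have tE : take m.+1 t = rcons t1 v by rewrite (take_nth x).
have pt1v : path (adj E D W (col \o delta) b) x (rcons t1 v).
  by rewrite -tE; apply: take_path.
have [pt1 uv] : path (adj E D W (col \o delta) b) x t1 /\
    adj E D W (col \o delta) b u v.
  by move: pt1v; rewrite rcons_path => /andP.
pose e1 := edge_of E D W y x; pose e2 := edge_of E D W u v.
have [_ [e1E ye1 xe1 c1]] := adjP linE yx.
have [_ [e2E ue2 ve2 c2]] := adjP linE uv.
have [a1 aD _] := deltaP _ (EWE _ e1E).
have [b2 bD _] := deltaP _ (EWE _ e2E).
have colab : col (delta e2) != col (delta e1).
  by move: c1 c2; rewrite /= -/e1 -/e2 => -> ->; case: (b).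
have [p [q [wp sp up [p2 uq sq ep]]]] :=
  lk _ _ (imset_f _ e2E) (imset_f _ e1E) colab.
pose ptr := trail E D W y (x :: rcons t1 v).
have ptrE : unzip1 ptr = e1 :: rcons (unzip1 (trail E D W x t1)) e2.
  rewrite /ptr /= /trail -cats1 pairmap_cat /unzip1 map_cat /= -/(trail E D W x t1).
  by rewrite cats1.
pose cyc := (e1, x) :: trail E D W x t1 ++ (e2, delta e2) :: p.
have sz : size cyc = l.
  rewrite /cyc [LHS]/= size_cat [size (_ :: p)]/= sp size_pairmap size_takel.
    by rewrite lE !addnS.
  exact: ltnW.
have u1E : unzip1 cyc = unzip1 ptr ++ unzip1 p.
  by rewrite ptrE /cyc /unzip1 /= map_cat /= -/(unzip1 p) cat_rcons.
have u2E : unzip2 cyc = (x :: t1) ++ rcons (delta e2 :: q) (delta e1).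
  rewrite /cyc /unzip2 /= map_cat /= -/(unzip2 p) p2.
  by rewrite -[map _ _]/(unzip2 _) unzip2_trail.
have ptrEW : {subset unzip1 ptr <= EW}.
  move=> e; rewrite ptrE in_cons mem_rcons in_cons => /or3P[/eqP->|/eqP->|] //.
  by move/(trail_edges linE pt1).
have xW : x \in W by move: yx; rewrite adj_sym => /(adj_sub linE).
have xD : x \notin D by case: (adjP linE yx) => -[].
have yD : y \notin D by case: (adjP linE yx) => -[].
have tWD z : z \in x :: t -> z \in W /\ z \notin D.
  by rewrite inE => /predU1P[-> //|/(path_adj_vertices linE xt)].
have t1t : {subset t1 <= t} by move=> z; apply: mem_take.
have layn z : z \in D -> z \notin ball j.
  by move=> /(subsetP DL); case/setDP.
rewrite -[l]sz; apply: (closed_walk_berge_cycle (x := delta e1)).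
- by rewrite sz lE -(prednK c0) !addnS.
- rewrite /cyc /= a1 xe1 walk_cat (trail_walk linE pt1) unzip2_trail /= -/u.
  by rewrite ue2 b2.
- by rewrite u2E last_cat last_rcons.
- rewrite u1E cat_uniq up andbT; apply/andP; split.
    apply: (walk_uniq_edges (D := D) (y := y)).
    + by move=> e /ptrEW/EWE/card2.
    + by rewrite /= ye1 xe1 (trail_walk linE pt1v).
    + rewrite unzip2_trail -tE; exact: (take_uniq m.+3 uyxt).
    + rewrite unzip2_trail -tE => z; rewrite inE => /predU1P[->//|].
      by move/(mem_take (n0 := m.+2) (s := x :: t)) => /tWD[].
  apply/hasPn=> e /ep[_ eb]; rewrite -Ej in eb; apply: contra eb.
  by move=> /ptrEW/EWE/EP[/spanP[]].
- rewrite u2E cat_uniq; apply/and3P; split.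
  + exact: (take_uniq m.+1 (s := x :: t) (proj2 (andP uyxt))).
  + apply/hasPn=> z; rewrite mem_rcons !in_cons => zq; apply/negP=> zt1.
    have zt : z \in x :: t.
      by move: zt1; rewrite !in_cons => /orP[->//|/t1t->]; rewrite orbT.
    have [zW zD] := tWD z zt.
    case/or3P: zq => [/eqP E1|/eqP E1|/sq zb].
    * by rewrite E1 aD in zD.
    * by rewrite E1 bD in zD.
    * by have := subsetP sW z zW; rewrite in_setD Ej zb.
  + rewrite rcons_uniq cons_uniq uq in_cons negb_or andbT -andbA; apply/and3P; split.
    * by apply: contraNneq colab => ->.
    * by apply: contra (layn _ aD) => /sq; rewrite Ej.
    * by apply: contra (layn _ bD) => /sq; rewrite Ej.
- by move=> e; rewrite u1E mem_cat => /orP[/ptrEW/EWE/EH|/ep[]].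
Qed.
End DenseLayer.

(** * Finding a dense layer *)

Local Open Scope ring_scope.

Lemma layer_size_bound (V : finType) (H : {set {set V}}) (r : V) h :
  (0 < h)%N -> (#|layer H r h| < #|V|)%N.
Proof.
case: h => // h _; apply: leq_trans (_ : #|[set~ r]|.+1 <= _)%N.
  rewrite ltnS; apply/subset_leq_card/subsetP=> v; rewrite in_setD in_setC1.
  by case/andP=> vn _; apply: contraNneq vn => ->; apply: root_ball.
by rewrite cardsC1 prednK //; apply/card_gt0P; exists r.
Qed.

(** Up to the first slow step the layers grow at least like the powers of N,
    and growth during h steps would exhaust the vertices. *)
Lemma slow_layer (R : realFieldType) (N : R) (V : finType) (H : {set {set V}})
    (r : V) h :
  (0 < h)%N -> 0 < N -> #|V|%:R <= N ^+ h ->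
  exists i, [/\ (i < h)%N, 0 < #|layer H r i|%:R :> R,
    #|layer H r i.+1|%:R < N * #|layer H r i|%:R &
    forall j, (j < i)%N -> N * #|layer H r j|%:R <= #|layer H r j.+1|%:R].
Proof.
move=> h0 N0 VN; pose slow i := #|layer H r i.+1|%:R < N * #|layer H r i|%:R.
have grow i : (forall j, (j < i)%N -> ~~ slow j) -> N ^+ i <= #|layer H r i|%:R.
  elim: i => [_|i IH hi].
    rewrite expr0 ler1n; apply/card_gt0P; exists r; rewrite in_setD root_ball.
    by rewrite in_set0.
  have := hi i (ltnSn i); rewrite -leNgt; apply: le_trans.
  by rewrite exprS ler_pM2l // IH // => j ji; apply: hi; apply: ltnW.
have exs : exists i, (i < h)%N && slow i.
  case: (pickP (fun i : 'I_h => slow i)) => [i si|no].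
    by exists i; rewrite ltn_ord.
  have := grow h (fun j jh => negbT (no (Ordinal jh))).
  by move/(le_trans VN); rewrite ler_nat leqNgt layer_size_bound.
case: (ex_minnP exs) => i /andP[ih si] mini.
have fast j : (j < i)%N -> ~~ slow j.
  move=> ji; apply/negP=> sj; have := mini j; rewrite sj (ltn_trans ji ih) => /(_ isT).
  by rewrite leqNgt ji.
exists i; split=> //; last by move=> j /fast; rewrite -leNgt.
by apply: lt_le_trans (grow i fast); rewrite exprn_gt0.
Qed.

Lemma ball_subset (V : finType) (H : {set {set V}}) (r : V) (W : {set V}) j :
  r \in W -> (forall e, e \in H -> e \subset W) -> ball H r j \subset W.
Proof.
move=> rW HW; elim: j => [|j IH]; first exact: sub0set.
apply/subsetP=> v; rewrite in_set => /or3P[/eqP-> //|/(subsetP IH) //|].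
by case/existsP=> e /and3P[/HW/subsetP sub ve _]; apply: sub.
Qed.

Lemma card_two_layers (V : finType) (H : {set {set V}}) (r : V) j :
  #|ball H r j.+2 :\: ball H r j| = (#|layer H r j| + #|layer H r j.+1|)%N.
Proof.
have s1 := subset_leq_card (sub_ballS H r j).
have s2 := subset_leq_card (sub_ballS H r j.+1).
rewrite !cardsD !(setIidPr _) ?sub_ballS //; last first.
  exact: subset_trans (sub_ballS _ _ _) (sub_ballS _ _ _).
lia.
Qed.

Theorem theorem5p2 (R : realType) (h k : nat) (V : finType)
    (H : {set {set V}}) :
  (2 <= h)%N -> (2 <= k)%N -> (0 < #|V|)%N ->
  uniform 3 H -> linear_hypergraph H ->
  18 * k%:R * (#|V|%:R `^ (1 + 1 / h%:R)) + 42 * k%:R * #|V|%:R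
    <= #|H|%:R :> R ->
  exists a : nat, (a <= 2 * h)%N /\
    forall l : nat, (a <= l < a + k)%N -> contains_berge_cycle l H.
Proof.
move=> h2 k2 V0 uniH linH.
set n : R := #|V|%:R; have n1 : 1 <= n by rewrite ler1n.
have n0 : 0 < n by rewrite ltr0n.
pose N := n `^ (1 / h%:R).
have N1 : 1 <= N by rewrite -(powRr0 n) ler_powR // divr_ge0.
have Nh : N ^+ h = n.
  rewrite -powR_mulrn ?powR_ge0 // -powRrM mul1r mulVf ?powRr1 ?ltW //.
  by rewrite pnatr_eq0; lia.
have -> : n `^ (1 + 1 / h%:R) = n * N.
  by rewrite powRD ?(gt_eqF n0) ?implybT // powRr1 ?ltW.
move=> dense.
have k0 : 0 < k%:R :> R by rewrite ltr0n ltnW.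
(* Any density strictly between (112/3 + 16N)k and (42 + 18N)k would do: the
   first is what the final counting consumes, the second is what H has. *)
pose x : R := (38 + 17 * N) * k%:R.
have [|W [_ dW mW]] := @dense_core V R x H set0 [set: V].
  rewrite (_ : induced _ _ _ = H); last first.
    by apply/setP=> e; rewrite inE setD0 subsetT andbT.
  rewrite cardsT -/n; apply: lt_le_trans dense.
  have : 0 < k%:R * n by rewrite mulr_gt0.
  have : 0 <= (N - 1) * (k%:R * n) by rewrite mulr_ge0 ?subr_ge0 // mulr_ge0 ?ltW.
  rewrite /x; nra.
have degW v : v \in W -> x < #|[set e in induced H set0 W | v \in e]|%:R.
  move=> vW; have := core_degree dW mW vW.
  by under eq_finset do rewrite setD0.
set H' := induced H set0 W in degW dW.
have H'H : H' \subset H := induced_sub _ _ _.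
have uniH' : uniform 3 H' by move=> e /(subsetP H'H)/uniH.
have linH' : linear_hypergraph H'.
  by move=> e f /(subsetP H'H) eH /(subsetP H'H); apply: linH.
have [r rW] : exists r, r \in W.
  apply/set0Pn; apply: contraTneq dW => W0; rewrite /H' W0 induced0.
    by rewrite !cards0 mulr0 ltxx.
  by move=> e /uniH e3; rewrite setD0 -card_gt0 e3.
have H'W e : e \in H' -> e \subset W by rewrite inE setD0 => /andP[].
have [|||i [ih Li0 slow fast]] := @slow_layer R N V H' r h.
- exact: ltnW.
- exact: lt_le_trans N1.
- by rewrite Nh.
have degL : x * #|layer H' r i|%:R <= (3 * #|edges_from_layer H' r i| +
    2 * (if i is i'.+1 then #|edges_from_layer H' r i'| else 0))%:R.
  apply: le_trans
    (_ : (\sum_(v in layer H' r i) #|[set e in H' | v \in e]|)%:R <= _); last first.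
    by rewrite ler_nat layer_degree_sum.
  rewrite natr_sum mulrC mulr_natl -sumr_const; apply: ler_sum => v vL.
  apply/ltW/degW; apply: (subsetP (ball_subset i.+1 rW H'W)).
  by case/setDP: vL.
(* If both layers were sparse, the degree sum over L_i would be at most
   16k(|L_i| + |L_(i+1)|) + (2/3) 16k(|L_(i-1)| + |L_i|), hence at most
   (112/3 + 16N)k |L_i|. *)
have [j ji dj] : exists2 j, (j <= i)%N &
    (16 * k * #|ball H' r j.+2 :\: ball H' r j| < 3 * #|edges_from_layer H' r j|)%N.
  have : 0 <= (N - 1) * (k%:R * #|layer H' r i|%:R).
    by rewrite mulr_ge0 ?subr_ge0 // mulr_ge0 ?ltW.
  have kLi : 0 < k%:R * #|layer H' r i|%:R :> R by rewrite mulr_gt0.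
  have : k%:R * #|layer H' r i.+1|%:R <= k%:R * (N * #|layer H' r i|%:R) :> R.
    by rewrite ler_pM2l // ltW.
  move=> kL1 kNL; have [|up] := leqP (3 * #|edges_from_layer H' r i|)
      (16 * k * #|ball H' r i.+2 :\: ball H' r i|); last by exists i.
  rewrite card_two_layers -(ler_nat R) !natrM natrD.
  case: i {ih Li0 slow} fast degL kL1 kNL kLi => [|i] fast degL kL1 kNL kLi upper.
    exfalso; move: degL; rewrite /x muln0 addn0 natrM; nra.
  exists i => //; rewrite ltnNge; apply/negP.
  have : k%:R * (N * #|layer H' r i|%:R) <= k%:R * #|layer H' r i.+1|%:R :> R.
    by rewrite ler_pM2l // fast.
  have : 0 <= (N - 1) * (k%:R * #|layer H' r i|%:R).
    by rewrite mulr_ge0 ?subr_ge0 // mulr_ge0 ?ler0n.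
  rewrite card_two_layers -(ler_nat R) !natrM natrD.
  move: degL; rewrite /x natrD !natrM; nra.
have [a aj cyc] := dense_layer_cycles uniH' linH' (ltnW k2) dj.
exists a; split; first by lia.
move=> l /cyc[C CH' bC]; exists C => //; exact: subset_trans CH' H'H.
Qed.
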